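(* Let $F(n)$ denote the $n$th Fibonacci number: $F(1)=F(2)=1$ and $F(n+2)=F(n+1)+F(n)$. Then for all values of $n$ where the exponents are nonnegative, the following formulas hold: \begin{align*} &\mathrm{ext}(0^n,n)=1,\\ &\mathrm{ext}(1^n,n)=2^n,\\ &\mathrm{ext}(1^{n-1}0,n)=2^n-1,\\ &\mathrm{ext}(1^{n-2}01,n)=2^n-5,\\ &\mathrm{ext}(1^{n-2}00,n)=2^n-(n+1),\\ &\mathrm{ext}((10)^{n/2},n)=F(n+2)\quad\text{if } n \text{ is even},\\ &\mathrm{ext}((10)^{\lfloor n/2\rfloor}1,n)=F(n+1)\quad\text{if } n \text{ is odd},\\ &\mathrm{ext}(10^{n-2}1,n)=3,\\ &\mathrm{ext}(10^{n-1},n)=n+1. \end{align*}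
   Context: A binary word $w$ is prefix normal if for every $1\le i\le |w|$, no (contiguous) substring of $w$ of length $i$ contains more $1$s than the prefix of $w$ of length $i$. For a binary word $w$ and an integer $m$, $\mathrm{ext}(w,m)$ denotes the number of binary words $w'$ such that the concatenation $ww'$ is prefix normal and has length $|w|+m$ (so $w'$ has length $m$). Exponents denote repetition: $u^k$ is $u$ concatenated $k$ times, applied to a single letter unless parentheses are present (so $10^{n-1}$ is $1$ followed by $n-1$ zeros).
   Formalization: The formulas for 1^{n-2}01 and 10^{n-2}1 are stated for n ≥ 3, and the one for (10)^{⌊n/2⌋}1 for odd n ≥ 3, since they fail at the omitted values: ext(01,2)=0 (not −1), ext(11,2)=4 (not 3), ext(1,1)=2 (not F(2)=1). *)

(* Defs.v *)
From mathcomp Require Import all_boot.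

Set Implicit Arguments.
Unset Strict Implicit.
Unset Printing Implicit Defensive.

(* The letter 1 is [true] and the letter 0 is [false]. *)
Notation word := (seq bool).

Definition ones (w : word) : nat := count_mem true w.

Definition wpow (u : word) (k : nat) : word := flatten (nseq k u).

Definition prefix_normal (w : word) : bool :=
  [forall i : 'I_(size w).+1, (0 < i) ==>
    [forall u : i.-tuple bool, infix u w ==> (ones u <= ones (take i w))]].

Definition ext (w : word) (m : nat) : nat :=
  #|[set w' : m.-tuple bool | prefix_normal (w ++ w')]|.

(* fib 1 = fib 2 = 1; the value fib 0 = 0 is the usual backward extension. *)
Fixpoint fib (n : nat) : nat :=
  match n with
  | 0 => 0
  | n1.+1 => match n1 with 0 => 1 | n2.+1 => fib n1 + fib n2 end
  end.

(* Main.v *)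
Require Import Defs.
From mathcomp Require Import all_boot.
From mathcomp Require Import zify.

(* Writing [P i] for the number of 1s in the prefix of length [i], a word is
   prefix normal iff [P] is subadditive.  When [|w| = |x| = n], it suffices to
   test [P (i + j) <= P i + P j] for [i <= j] and [i + j <= 2n], so that
   [i <= n] and [P i] depends on [w] only.  For each of the nine words [w] this
   turns prefix normality of [wx] into an elementary condition on [x] (for the
   alternating words: [wx] has no factor 11), and the words [x] satisfying it
   are counted by recursion on the first letter. *)

(** * Counting 1s in prefixes *)

Definition prefix_ones (w : word) (i : nat) : nat := ones (take i w).

Lemma ones_cat (u v : word) : ones (u ++ v) = ones u + ones v.
Proof. exact: count_cat. Qed.

Lemma ones_cons (b : bool) (w : word) : ones (b :: w) = b + ones w.
Proof. by case: b. Qed.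

Lemma ones_zeros (w : word) : ones w + count_mem false w = size w.
Proof.
rewrite -(count_predC (pred1 true) w) /ones; congr (_ + _).
by apply: eq_count => -[].
Qed.

Lemma prefix_onesD (w : word) (i j : nat) :
  prefix_ones w (i + j) = prefix_ones w i + ones (take j (drop i w)).
Proof. by rewrite /prefix_ones takeD ones_cat. Qed.

Lemma prefix_onesS (w : word) (i : nat) :
  prefix_ones w i.+1 = prefix_ones w i + nth false w i.
Proof.
rewrite -addn1 prefix_onesD; congr (_ + _).
case: (ltnP i (size w)) => hi; last by rewrite drop_oversize // nth_default.
by rewrite (drop_nth false hi) /= take0 /ones /=; case: (nth _ _ _).
Qed.

Lemma prefix_ones_le (w : word) (i j : nat) :
  i <= j -> prefix_ones w i <= prefix_ones w j <= prefix_ones w i + (j - i).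
Proof.
move=> /subnKC <-; rewrite prefix_onesD leq_addr addKn leq_add2l.
by rewrite (leq_trans (count_size _ _)) // size_take_min geq_minl.
Qed.

Lemma prefix_ones_size (w : word) : prefix_ones w (size w) = ones w.
Proof. by rewrite /prefix_ones take_size. Qed.

Lemma prefix_ones_oversize (w : word) (i : nat) :
  size w <= i -> prefix_ones w i = ones w.
Proof. by move=> h; rewrite /prefix_ones take_oversize. Qed.

Lemma prefix_ones_cat (u v : word) (i : nat) :
  prefix_ones (u ++ v) i = prefix_ones u i + prefix_ones v (i - size u).
Proof.
rewrite /prefix_ones take_cat; case: ltnP => h.
  (* [a <= b] is by definition [a - b == 0], so [eqP] rewrites the truncated difference to 0. *)
  by rewrite (eqP (ltnW h)) take0 addn0.
by rewrite ones_cat (take_oversize h).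
Qed.

Lemma prefix_ones_nseq (b : bool) (k i : nat) :
  prefix_ones (nseq k b) i = b * minn i k.
Proof.
elim: k i => [|k IH] [|i] //=; rewrite ?muln0 ?minn0 //.
by rewrite -[LHS]/((b == true) + prefix_ones (nseq k b) i) IH minnSS mulnS; case: b {IH}.
Qed.

Lemma prefix_ones_cons (b : bool) (w : word) (i : nat) :
  prefix_ones (b :: w) i = b * (0 < i) + prefix_ones w i.-1.
Proof. by rewrite /prefix_ones; case: i b => [|i] [] //=; rewrite take0. Qed.

Lemma prefix_ones_nil (i : nat) : prefix_ones [::] i = 0.
Proof. by []. Qed.

(** Turns prefix counts of the concrete words into piecewise linear arithmetic for [lia]. *)
Definition prefix_onesE := (prefix_ones_cat, prefix_ones_cons, prefix_ones_nseq,
  prefix_ones_nil, size_cat, size_nseq).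

Lemma prefix_ones0 (w : word) : prefix_ones w 0 = 0.
Proof. by rewrite /prefix_ones take0. Qed.

Lemma prefix_ones_max (w : word) (i : nat) : prefix_ones w i <= ones w.
Proof. by rewrite -[w in ones w](cat_take_drop i) ones_cat leq_addr. Qed.

(** Settles subadditivity at [i] and [j] whenever the first [i] letters are all 1s. *)
Lemma prefix_ones_addl (w : word) (i j : nat) :
  prefix_ones w (i + j) <= i + prefix_ones w j.
Proof. by have /andP[_] := prefix_ones_le w _ _ (leq_addl i j); rewrite addnK [_ w j + i]addnC. Qed.

(** * Prefix normality as subadditivity *)

Lemma prefix_normalP (w : word) :
  reflect (forall i j, prefix_ones w (i + j) <= prefix_ones w i + prefix_ones w j)
    (prefix_normal w).
Proof.
apply: (iffP forallP) => [nw i j | nw [i hi] /=].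
  have infix_le k l : l <= size w -> ones (take l (drop k w)) <= prefix_ones w l.
    move=> hl; case: (posnP l) => [->|l0]; first by rewrite take0.
    (* A window running past the end of [w] is really the suffix [drop k w]: compare it with the
       prefix of its true length, then use monotonicity. *)
    case: (leqP l (size (drop k w))) => hk; last first.
      have {}hk : size (drop k w) <= l by apply: ltnW.
      rewrite take_oversize //.
      set u := drop k w in hk *; case: (posnP (size u)) => [/size0nil -> //|u0].
      have hu : size u < (size w).+1 by rewrite ltnS size_drop leq_subr.
      have /implyP/(_ u0)/forallP/(_ (in_tuple u))/implyP := nw (Ordinal hu).
      move=> /(_ (infix_drop _ _)) /leq_trans; apply.
      by case/andP: (prefix_ones_le w _ _ hk).
    have /implyP/(_ l0)/forallP := nw (Ordinal (hl : l < (size w).+1)).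
    have st : size (take l (drop k w)) == l by rewrite size_takel.
    move=> /(_ (Tuple st))/implyP; apply.
    by apply/infixP; exists (take k w), (drop l (drop k w)); rewrite !cat_take_drop.
  rewrite prefix_onesD leq_add2l.
  case: (leqP j (size w)) => hj; first exact: infix_le.
  rewrite take_oversize ?size_drop; last by rewrite leq_subLR (leq_trans (ltnW hj)) ?leq_addl.
  rewrite prefix_ones_oversize; last exact: ltnW.
  by rewrite -[w in X in _ <= X](cat_take_drop i) ones_cat leq_addl.
apply/implyP => _; apply/forallP => u; apply/implyP => /infixP[s [t def_w]].
(* The factor [u] is the window of length [i] at position [size s]. *)
have := nw (size s) i; rewrite prefix_onesD.
have -> : take i (drop (size s) w) = u.
  by rewrite def_w drop_size_cat // take_size_cat // size_tuple.
by rewrite leq_add2l.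
Qed.

(* By symmetry and saturation of the prefix counts beyond the end of the word. *)
Lemma prefix_normal_half (w : word) :
  (forall i j, i <= j -> i + j <= size w ->
     prefix_ones w (i + j) <= prefix_ones w i + prefix_ones w j) ->
  prefix_normal w.
Proof.
move=> nw; apply/prefix_normalP => i j.
wlog le_ij : i j / i <= j.
  move=> W; case: (leqP i j) => [|/ltnW] h; first exact: W.
  by rewrite addnC [X in _ <= X]addnC W.
case: (leqP (i + j) (size w)) => [|hs]; first exact: nw.
case: (leqP (size w) j) => [hj | hj].
  by rewrite (prefix_ones_oversize _ j hj) prefix_ones_oversize ?leq_addl //; lia.
have /(prefix_ones_le w _ _)/andP[mono _] : size w - j <= i by lia.
have eqs : prefix_ones w (i + j) = prefix_ones w (size w - j + j).
  by rewrite subnK ?[RHS]prefix_ones_size ?prefix_ones_oversize // ltnW.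
rewrite eqs (leq_trans _ (leq_add mono (leqnn _))) //.
case: (leqP (size w - j) j) => [|/ltnW] h; first by apply: nw; lia.
by rewrite addnC [X in _ <= X]addnC nw //; lia.
Qed.

(** * Counting words by their first letter *)

Definition num_words (m : nat) (p : pred word) : nat :=
  #|[set x : m.-tuple bool | p x]|.

Lemma eq_num_words (m : nat) (p q : pred word) :
  (forall x, size x = m -> p x = q x) -> num_words m p = num_words m q.
Proof.
by move=> pq; apply: eq_card => x; rewrite !inE pq // size_tuple.
Qed.

Lemma num_words0 (p : pred word) : num_words 0 p = p [::].
Proof.
have -> : num_words 0 p = #|[pred _ : 0.-tuple bool | p [::]]|.
  by apply: eq_card => x; rewrite !inE tuple0.
case: (p [::]); last exact: card0.
by rewrite -[RHS]/(2 ^ 0) -card_bool -card_tuple; apply: eq_card => x; rewrite !inE.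
Qed.

Lemma num_wordsS (m : nat) (p : pred word) :
  num_words m.+1 p =
  num_words m (fun x => p (true :: x)) + num_words m (fun x => p (false :: x)).
Proof.
pose f b (x : m.-tuple bool) : m.+1.-tuple bool := [tuple of b :: x].
have f_inj b : injective (f b) by move=> x y [] /val_inj.
rewrite /num_words -(card_imset _ (f_inj true)) -(card_imset _ (f_inj false)).
set A := _ @: _; set B := _ @: _.
have -> : [set x : m.+1.-tuple bool | p x] = A :|: B.
  apply/setP => x; case/tupleP: x => b x; rewrite !inE.
  apply/idP/orP => [px | [] /imsetP[y]].
  - case: b px => px; [left | right]; apply/imsetP; exists x => //; rewrite ?inE //;
      exact: val_inj.
  - by rewrite inE => py /(congr1 val) /= ->.
  - by rewrite inE => py /(congr1 val) /= ->.
rewrite cardsU; suff -> : A :&: B = set0 by rewrite cards0 subn0.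
apply/setP => x; rewrite !inE; apply/negP => /andP[/imsetP[y _ ->]].
by case/imsetP => z _ [].
Qed.

Lemma num_words_xpredT (m : nat) : num_words m xpredT = 2 ^ m.
Proof.
have -> : num_words m xpredT = #|{: m.-tuple bool}|.
  by apply: eq_card => x; rewrite !inE.
by rewrite card_tuple card_bool.
Qed.

Lemma num_words_xpred0 (m : nat) : num_words m xpred0 = 0.
Proof. by apply: eq_card0 => x; rewrite !inE. Qed.

Lemma num_words_predC (m : nat) (p : pred word) :
  num_words m (predC p) = 2 ^ m - num_words m p.
Proof.
suff <- : num_words m (predC p) + num_words m p = 2 ^ m by rewrite addnK.
elim: m p => [|m IH] p; first by rewrite !num_words0 /=; case: (p _).
by rewrite !num_wordsS addnACA !IH expnS mul2n addnn.
Qed.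

Lemma num_words_count0 (m : nat) (b : bool) :
  num_words m (fun x => count_mem b x <= 0) = 1.
Proof.
elim: m => [|m IH]; first by rewrite num_words0.
by rewrite num_wordsS; case: b IH => /= ->; rewrite num_words_xpred0.
Qed.

Lemma num_words_count1 (m : nat) (b : bool) :
  num_words m (fun x => count_mem b x <= 1) = m.+1.
Proof.
elim: m => [|m IH]; first by rewrite num_words0.
rewrite num_wordsS; have := num_words_count0 m b.
by case: b IH => /= -> ->; rewrite ?addn1.
Qed.

(** * Criteria on [x] for the non-alternating words *)

Lemma prefix_normal_zeros (n : nat) (x : word) : size x = n ->
  prefix_normal (nseq n false ++ x) = (count_mem true x <= 0).
Proof.
move=> sx; apply/prefix_normalP/idP => [/(_ n n) | x0 i j].
  by rewrite !prefix_onesE addnK subnn prefix_ones0 -sx prefix_ones_size.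
by have := prefix_ones_max x (i + j - n); rewrite !prefix_onesE /ones; lia.
Qed.

(** The half criterion only involves [i <= n], where P i = i. *)
Lemma prefix_normal_ones (n : nat) (x : word) : size x = n ->
  prefix_normal (nseq n true ++ x).
Proof.
move=> sx; apply: prefix_normal_half => i j le_ij; rewrite !size_cat size_nseq sx.
by move=> hs; have := prefix_ones_addl (nseq n true ++ x) i j; rewrite !prefix_onesE; lia.
Qed.

(** Pairs with [i <= n] are automatic. The only other pair in the half criterion is i = j = n+1,
    which reads n + [ones x] <= 2n. *)
Lemma prefix_normal_ones_0 (n : nat) (x : word) : size x = n.+1 ->
  prefix_normal ((nseq n true ++ [:: false]) ++ x) = ~~ (count_mem false x <= 0).
Proof.
move=> sx; have h0 := prefix_ones0 x.
have := ones_zeros x; have := prefix_ones_size x; rewrite sx => hx.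
move: (count_mem false x) => z zx; apply/idP/idP => [/prefix_normalP/(_ n.+1 n.+1) | nz].
  by rewrite !prefix_onesE /= !addn1 addnK subnn; lia.
apply: prefix_normal_half => i j le_ij; rewrite !size_cat size_nseq sx /= => hs.
have := prefix_ones_addl ((nseq n true ++ [:: false]) ++ x) i j.
case: (leqP i n) => hi; first by rewrite !prefix_onesE /=; lia.
have [-> ->] : i = n.+1 /\ j = n.+1 by lia.
by rewrite !prefix_onesE /= !addn1 addnK subnn; lia.
Qed.

(** Once i > n, both counts on the right are at least n, while the left one is at most n + [ones x].
    So i = j = n+2 is decisive: [x] has at most n 1s. *)
Lemma prefix_normal_ones_00 (n : nat) (x : word) : size x = n.+2 ->
  prefix_normal ((nseq n true ++ [:: false; false]) ++ x) =
  ~~ (count_mem false x <= 1).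
Proof.
move=> sx; have h0 := prefix_ones0 x.
have := ones_zeros x; have := prefix_ones_size x; rewrite sx => hx.
move: (count_mem false x) => z zx; apply/idP/idP => [/prefix_normalP/(_ n.+2 n.+2) | nz].
  by rewrite !prefix_onesE /= !addn2 addnK subnn; lia.
apply: prefix_normal_half => i j le_ij; rewrite !size_cat size_nseq sx /= => hs.
have := prefix_ones_addl ((nseq n true ++ [:: false; false]) ++ x) i j.
have := prefix_ones_max x (i + j - n.+2).
case: (leqP i n) => hi; rewrite !prefix_onesE /=; rewrite ?addn2; lia.
Qed.

(** The pair i = j = n+1 reads 1 + [ones x] <= 2. Conversely, for positive i and j the right side is
    at least 2. *)
Lemma prefix_normal_1_zeros (n : nat) (x : word) : size x = n.+1 ->
  prefix_normal ((true :: nseq n false) ++ x) = (count_mem true x <= 1).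
Proof.
move=> sx; apply/prefix_normalP/idP => [/(_ n.+1 n.+1) | x0 i j].
  by rewrite !prefix_onesE /= size_nseq addnK subnn prefix_ones0 -sx prefix_ones_size -/(ones x); lia.
have := prefix_ones_max x (i + j - n.+1).
case: i => [|i]; first by rewrite add0n leq_addl.
case: j => [|j]; first by rewrite addn0 leq_addr.
by rewrite !prefix_onesE /= size_nseq /ones; lia.
Qed.

(** The two conditions are the pairs (n+2, n+2) and (n+2, n+4). Pairs with i <= n+1 are automatic;
    (n+2, n+3) and (n+3, n+3) follow because one letter adds at most one 1. *)
Lemma prefix_normal_ones_01 (n : nat) (x : word) : size x = n.+3 ->
  prefix_normal ((nseq n.+1 true ++ [:: false; true]) ++ x) =
  (prefix_ones x n.+1 <= n) && (ones x <= (prefix_ones x 1 + n).+1).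
Proof.
set w := nseq n.+1 true ++ _ => sx.
have Pw i : prefix_ones w i = minn i n.+1 + (n.+2 < i).
  by rewrite /w !prefix_onesE /=; lia.
have sw : size w = n.+3 by rewrite /w !prefix_onesE /= addn2.
clearbody w; have h0 := prefix_ones0 x; have := prefix_ones_size x; rewrite sx => hx.
apply/idP/andP => [/prefix_normalP nw | [x1 x2]].
  have := nw n.+2 n.+2; have := nw n.+2 n.+4.
  have -> : n.+2 + n.+4 = n.+3 + n.+3 by lia.
  have -> : n.+2 + n.+2 = n.+3 + n.+1 by lia.
  by rewrite !prefix_ones_cat !Pw sw -[n.+4]addn1 !addKn hx (eqP (leqnSn n.+2)) h0; split; lia.
apply: prefix_normal_half => i j le_ij; rewrite size_cat sw sx => hs.
have := prefix_ones_addl (w ++ x) i j.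
case: (leqP i n.+1) => hi.
  have i0 : i - n.+3 = 0 by lia.
  by rewrite [prefix_ones _ i]prefix_ones_cat Pw sw i0; lia.
rewrite !prefix_ones_cat !Pw sw.
have /andP[_] := prefix_ones_le x _ _ (leqnSn n.+1).
have /andP[_] := prefix_ones_le x _ _ (leq0n 1).
have [[-> ->]|[[-> ->]|[[-> ->]|[-> ->]]]] :
  (i = n.+2 /\ j = n.+2) \/ (i = n.+2 /\ j = n.+3) \/
  (i = n.+2 /\ j = n.+4) \/ (i = n.+3 /\ j = n.+3) by lia.
- rewrite (_ : n.+2 + n.+2 - n.+3 = n.+1); lia.
- rewrite (_ : n.+2 + n.+3 - n.+3 = n.+2); lia.
- rewrite (_ : n.+2 + n.+4 - n.+3 = n.+3); last by lia.
  rewrite (_ : n.+4 - n.+3 = 1); lia.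
- by rewrite addnK subnn; lia.
Qed.

Lemma prefix_normal_1_zeros_1 (n : nat) (x : word) : size x = n.+3 ->
  prefix_normal ((true :: nseq n.+1 false ++ [:: true]) ++ x) =
  (prefix_ones x n.+1 <= 0) && (ones x <= 1).
Proof.
set w := true :: _ => sx.
have Pw i : prefix_ones w i = (0 < i) + (n.+2 < i).
  by rewrite /w !prefix_onesE /=; lia.
have sw : size w = n.+3 by rewrite /w /= !prefix_onesE /= addn1.
clearbody w; have h0 := prefix_ones0 x; have := prefix_ones_size x; rewrite sx => hx.
apply/idP/andP => [/prefix_normalP nw | [x1 x2]].
  have := nw n.+2 n.+2; have := nw n.+2 n.+4.
  have -> : n.+2 + n.+4 = n.+3 + n.+3 by lia.
  have -> : n.+2 + n.+2 = n.+3 + n.+1 by lia.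
  (* The pair (n+2, n+4) bounds [ones x] by 1 plus the first letter of [x], and that letter is 0 by
     the pair (n+2, n+2). *)
  have /andP[+ _] := prefix_ones_le x _ _ (ltn0Sn n).
  by rewrite !prefix_ones_cat !Pw sw -[n.+4]addn1 !addKn hx (eqP (leqnSn n.+2)) h0; split; lia.
apply: prefix_normal_half => -[|i] j le_ij _; first by rewrite add0n leq_addl.
rewrite !prefix_ones_cat !Pw sw.
have := prefix_ones_max x (i.+1 + j - n.+3).
(* Either the part of [x] reached has no 1 and the left side is at most 2, or the larger index [j]
   is at least n+3 and the right side is at least 3. *)
case: (leqP (i.+1 + j - n.+3) n.+1) => [/(prefix_ones_le x _ _)/andP[+ _]|]; lia.
Qed.

(** * Counting the extensions for the words ending in 01 or in 1 after zeros *)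

Lemma num_words_ones_prefix (n : nat) :
  num_words n.+2 (fun y => n <= prefix_ones y n) = 4.
Proof.
elim: n => [|n IH]; first by rewrite !num_wordsS !num_words0.
rewrite num_wordsS (@eq_num_words _ _ (fun y => n <= prefix_ones y n)); last first.
  by move=> y _; rewrite prefix_ones_cons /= mul1n ltnS.
rewrite IH (@eq_num_words _ _ xpred0) ?num_words_xpred0 // => y _.
by rewrite prefix_ones_cons /=; have := prefix_ones_addl y n 0; rewrite addn0 prefix_ones0; lia.
Qed.

(** The five excluded words are 1^(n+1) followed by two free letters, and 01^(n+2). *)
Lemma num_words_ones_01 (n : nat) :
  num_words n.+3 (fun x => (prefix_ones x n.+1 <= n) &&
                           (ones x <= (prefix_ones x 1 + n).+1)) = 2 ^ n.+3 - 5.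
Proof.
pose bad (x : word) := (n < prefix_ones x n.+1) || ((prefix_ones x 1 + n).+1 < ones x).
rewrite (@eq_num_words _ _ (predC bad)); last first.
  by move=> x _; rewrite /bad /= negb_or -!leqNgt.
rewrite num_words_predC num_wordsS; congr (_ - _).
rewrite (@eq_num_words _ _ (fun y => n <= prefix_ones y n)); last first.
  move=> y sy; rewrite /bad !prefix_ones_cons prefix_ones0 ones_cons /=.
  by have := prefix_ones_size y; rewrite sy; have := prefix_ones_le y n n.+2; lia.
rewrite num_words_ones_prefix.
rewrite (@eq_num_words _ _ (fun y => count_mem false y <= 0)) ?num_words_count0 //.
move=> y sy; rewrite /bad !prefix_ones_cons prefix_ones0 ones_cons /=.
have := ones_zeros y; rewrite sy; move: (count_mem false y) => z.
by have := prefix_ones_addl y n 0; rewrite addn0 prefix_ones0; lia.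
Qed.

(** The words counted are 0^n followed by 00, 01 or 10. *)
Lemma num_words_zeros_prefix (n : nat) :
  num_words n.+2 (fun x => (prefix_ones x n <= 0) && (ones x <= 1)) = 3.
Proof.
elim: n => [|n IH]; first by rewrite !num_wordsS !num_words0.
by rewrite num_wordsS -[RHS]IH (@eq_num_words _ _ xpred0) ?num_words_xpred0.
Qed.

(** * Alternating words and Fibonacci numbers *)

Definition alternating (n : nat) : word := mkseq (fun i => ~~ odd i) n.

(** Not transitive: [sorted sparse] compares neighbours only, and so excludes exactly the factor
    11. *)
Definition sparse : rel bool := fun a b => ~~ (a && b).

(** Remove two letters at a time: each such pair holds at most one 1. *)
Lemma ones_sparse (s : word) : sorted sparse s -> ones s <= uphalf (size s).
Proof.
have [k] := ubnP (size s); elim: k s => // k IH [|a [|b s]] //=.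
  by case: a.
move=> sk /andP[ab /path_sorted /(IH _ (ltnW sk))].
by rewrite -/(ones s); case: a b ab => [] [] //= _; lia.
Qed.

Lemma prefix_ones_alternating (n i : nat) :
  i <= n -> prefix_ones (alternating n) i = uphalf i.
Proof.
elim: i => [|i IH] hi; first exact: prefix_ones0.
by rewrite prefix_onesS nth_mkseq // IH ?(ltnW hi) //=; lia.
Qed.

Lemma sparse_alternating (n : nat) : sorted sparse (alternating n).
Proof.
apply/(sortedP false) => i; rewrite size_mkseq => hi.
by rewrite !nth_mkseq ?(ltnW hi) // /sparse /=; case: (odd i).
Qed.

(** As n > 1, P 2 = 1, so the pairs (i, 2) forbid 11. Conversely, a window of length i without 11
    has at most [uphalf i] 1s, which is P i for i <= n. *)
Lemma prefix_normal_alternating (n : nat) (x : word) :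
  1 < n -> size x = n ->
  prefix_normal (alternating n ++ x) = sorted sparse (alternating n ++ x).
Proof.
move=> n1 sx; have sw : size (alternating n) = n by rewrite size_mkseq.
have Pw i : i <= n -> prefix_ones (alternating n ++ x) i = uphalf i.
  move=> hi; rewrite prefix_ones_cat sw (eqP hi) prefix_ones0 addn0.
  exact: prefix_ones_alternating.
apply/idP/idP => [/prefix_normalP nw | nw].
  apply/(sortedP false) => i _; have := nw i 2.
  rewrite (Pw 2) // addn2 !prefix_onesS /sparse.
  by case: (nth _ _ i) (nth _ _ i.+1) => [] []; lia.
apply: prefix_normal_half => i j le_ij; rewrite size_cat sw sx => hs.
(* The window is taken of the smaller length [i], at position [j], because P i is known only for i
   <= n. *)
rewrite addnC prefix_onesD addnC leq_add2r Pw; last by lia.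
rewrite (leq_trans (ones_sparse _ _)) ?take_sorted ?drop_sorted //.
by rewrite uphalf_leq // size_take_min geq_minl.
Qed.

Lemma sparse_alternating_cat (n : nat) (x : word) :
  sorted sparse (alternating n.+1 ++ x) = path sparse (~~ odd n) x.
Proof.
have := sparse_alternating n.+1; rewrite /alternating mkseqS.
by case: (mkseq _ n) => [|a w] //=; rewrite cat_path last_rcons => ->.
Qed.

Lemma wpow_alternating (k : nat) : wpow [:: true; false] k = alternating k.*2.
Proof.
elim: k => // k IH; rewrite -addn1 /wpow nseqD flatten_cat -/(wpow _ k) IH.
by rewrite addn1 doubleS /alternating !mkseqS -!cats1 -catA /= odd_double.
Qed.

Lemma path_sparse_false (s : word) : path sparse false s = sorted sparse s.
Proof. by case: s. Qed.

Lemma num_words_sparse (n : nat) : num_words n (sorted sparse) = fib n.+2.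
Proof.
have [k] := ubnP n; elim: k n => // k IH [|[|n]] hn.
- by rewrite num_words0.
- by rewrite num_wordsS !num_words0.
rewrite -[RHS]/(fib n.+3 + fib n.+2) addnC num_wordsS -(IH n.+1) // -(IH n); last exact: ltnW.
congr (_ + _); last by apply: eq_num_words => x _; exact: path_sparse_false.
(* After a leading 1 the next letter must be 0, leaving a free sparse word of length [n]. *)
rewrite num_wordsS (@eq_num_words _ _ xpred0) // num_words_xpred0 add0n.
by apply: eq_num_words => x _; exact: path_sparse_false.
Qed.

(* Every natural subtraction below is exact under its hypothesis on n. *)
Theorem lemma6 (n : nat) :
  ext (nseq n false) n = 1 /\
  ext (nseq n true) n = 2 ^ n /\
  (1 <= n -> ext (nseq (n - 1) true ++ [:: false]) n = 2 ^ n - 1) /\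
  (3 <= n -> ext (nseq (n - 2) true ++ [:: false; true]) n = 2 ^ n - 5) /\
  (2 <= n -> ext (nseq (n - 2) true ++ [:: false; false]) n = 2 ^ n - (n + 1)) /\
  (~~ odd n -> ext (wpow [:: true; false] (n %/ 2)) n = fib (n + 2)) /\
  (odd n -> 3 <= n ->
     ext (wpow [:: true; false] (n %/ 2) ++ [:: true]) n = fib (n + 1)) /\
  (3 <= n -> ext (true :: nseq (n - 2) false ++ [:: true]) n = 3) /\
  (1 <= n -> ext (true :: nseq (n - 1) false) n = n + 1).
Proof.
have extE w m : ext w m = num_words m (fun x => prefix_normal (w ++ x)) by [].
rewrite !extE; split; [|split; [|split; [|split; [|split; [|split; [|split; [|split]]]]]]].
- by rewrite (eq_num_words _ _ _ (prefix_normal_zeros n)) num_words_count0.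
- by rewrite (eq_num_words _ _ _ (prefix_normal_ones n)) num_words_xpredT.
- case: n => // n _; rewrite subn1 (eq_num_words _ _ _ (prefix_normal_ones_0 n)).
  by rewrite (num_words_predC _ (fun x => count_mem false x <= 0)) num_words_count0.
- case: n => [|[|[|n]]] // _; rewrite subn2.
  by rewrite (eq_num_words _ _ _ (prefix_normal_ones_01 n)) num_words_ones_01.
- case: n => [|[|n]] // _; rewrite subn2 (eq_num_words _ _ _ (prefix_normal_ones_00 n)).
  by rewrite (num_words_predC _ (fun x => count_mem false x <= 1)) num_words_count1 addn1.
- case: n => [|[|n]] // n_even.
    (* For n = 0, outside the alternating criterion, the empty word gives 1 = F(2). *)
    by rewrite num_words0; suff -> : prefix_normal [::] by []; apply/prefix_normalP.
  rewrite divn2 wpow_alternating even_halfK // addn2 -num_words_sparse.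
  apply: eq_num_words => x sx.
  rewrite prefix_normal_alternating // sparse_alternating_cat.
  (* An alternating word of even length ends in 0, so the first letter of [x] is unconstrained. *)
  rewrite -[~~ odd n.+1]/(odd n.+2) (negbTE n_even).
  exact: path_sparse_false.
- case: n => // n n_odd n3; have n_even : ~~ odd n by [].
  have -> : n.+1 %/ 2 = n./2 by rewrite divn2 /= uphalf_half (negbTE n_even).
  have -> : wpow [:: true; false] n./2 ++ [:: true] = alternating n.+1.
    by rewrite wpow_alternating even_halfK // /alternating mkseqS n_even cats1.
  rewrite (@eq_num_words _ _ (path sparse true)) => [|x sx]; last first.
    by rewrite prefix_normal_alternating ?(ltnW n3) // sparse_alternating_cat n_even.
  (* Here the alternating word ends in 1, so [x] starts with 0 and one letter fewer is free: hence
     F(n+1) in place of F(n+2). *)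
  rewrite num_wordsS (@eq_num_words _ _ xpred0) // num_words_xpred0 add0n addn1.
  rewrite -num_words_sparse; apply: eq_num_words => x _; exact: path_sparse_false.
- case: n => [|[|[|n]]] // _; rewrite subn2.
  by rewrite (eq_num_words _ _ _ (prefix_normal_1_zeros_1 n)) num_words_zeros_prefix.
- case: n => // n _; rewrite subn1 (eq_num_words _ _ _ (prefix_normal_1_zeros n)).
  by rewrite num_words_count1 addn1.
Qed.
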